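(* Let $E$ be a field of nonzero characteristic which is algebraic over its prime subfield. Then the following are equivalent: (1) $E$ has only finitely many maximal subrings up to isomorphism. (2) $E$ has only finitely many maximal subrings. (3) $E$ has a subfield $F$ which has no maximal subrings and such that $[E:F]$ is finite. (4) Every descending chain $\cdots\subset R_2\subset R_1\subset R_0=E$, where each $R_i$ is a maximal subring of $R_{i-1}$ for $i\geq 1$, is finite.
   Context: All rings are commutative with $1\neq 0$; subrings and homomorphisms are unital. A proper subring $S$ of a ring $R$ is a maximal subring of $R$ if it is maximal with respect to inclusion among the proper subrings of $R$; a ring need not possess any maximal subring. ''Up to isomorphism'' means that maximal subrings are counted up to ring isomorphism. *)

(* Defs.v *)
From HB Require Import structures.
From mathcomp Require Import all_boot all_order all_algebra.
From mathcomp Require Import all_classical.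

Set Implicit Arguments.
Unset Strict Implicit.
Unset Printing Implicit Defensive.

Import GRing.Theory.

Local Open Scope classical_set_scope.
Local Open Scope ring_scope.

(* [S : subringClosed R] is a subset of [R] bundled with the proof that it
   contains 1 and is closed under subtraction and multiplication; by the next
   lemma, counting such bundles is the same as counting the subsets. *)
Lemma subring_ext (R : pzRingType) (S T : subringClosed R) :
  S =i T -> S = T.
Proof.
case: S => S [[a] [b] [c] [d]]; case: T => T [[a'] [b'] [c'] [d']] eST.
have E : S = T by apply: funext => x; exact: eST x.
case: _ / E a' b' c' d' {eST} => a' b' c' d'.
by rewrite (Prop_irrelevance a a') (Prop_irrelevance b b')
  (Prop_irrelevance c c') (Prop_irrelevance d d').
Qed.

Definition full_subring (R : pzRingType) : {pred R} := fun=> true.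

Fact full_subring_closed (R : pzRingType) : subring_closed (@full_subring R).
Proof. by split. Qed.

HB.instance Definition _ (R : pzRingType) :=
  GRing.isSubringClosed.Build R (@full_subring R) (@full_subring_closed R).

Definition proper_subring (R : pzRingType) (S T : subringClosed R) : Prop :=
  {subset S <= T} /\ S <> T.

Definition maximal_subring (R : pzRingType) (S T : subringClosed R) : Prop :=
  proper_subring S T /\
  forall U : subringClosed R,
    proper_subring U T -> {subset S <= U} -> U = S.

Definition maximal_subrings (R : pzRingType) (T : subringClosed R) :
  set (subringClosed R) := [set S | maximal_subring S T].

Record subring_type (R : comNzRingType) (S : subringClosed R) : Type :=
  SubringElt { subring_val :> R; _ : subring_val \in S }.

HB.instance Definition _ (R : comNzRingType) (S : subringClosed R) :=
  [isSub for @subring_val R S].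
HB.instance Definition _ (R : comNzRingType) (S : subringClosed R) :=
  [Choice of subring_type S by <:].
HB.instance Definition _ (R : comNzRingType) (S : subringClosed R) :=
  [SubChoice_isSubComNzRing of subring_type S by <:].

Definition ring_isomorphic (A B : comNzRingType) : Prop :=
  exists f : {rmorphism A -> B}, bijective f.

Definition iso_class (R : comNzRingType) (C : set (subringClosed R))
    (S : subringClosed R) : set (subringClosed R) :=
  [set T | C T /\ ring_isomorphic (subring_type S) (subring_type T)].

Definition finite_up_to_iso (R : comNzRingType) (C : set (subringClosed R)) :
  Prop := finite_set [set iso_class C S | S in C].

Record subfield_type (E : fieldType) (F : divringClosed E) : Type :=
  SubfieldElt { subfield_val :> E; _ : subfield_val \in F }.

HB.instance Definition _ (E : fieldType) (F : divringClosed E) :=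
  [isSub for @subfield_val E F].
HB.instance Definition _ (E : fieldType) (F : divringClosed E) :=
  [Choice of subfield_type F by <:].
HB.instance Definition _ (E : fieldType) (F : divringClosed E) :=
  [SubChoice_isSubIntegralDomain of subfield_type F by <:].
HB.instance Definition _ (E : fieldType) (F : divringClosed E) :=
  [SubIntegralDomain_isSubField of subfield_type F by <:].

Definition prime_subfield (E : fieldType) : {pred E} :=
  fun x => `[< forall K : divringClosed E, x \in K >].

Fact prime_subfield_closed (E : fieldType) : divring_closed (@prime_subfield E).
Proof.
split=> [|x y /asboolP hx /asboolP hy|x y /asboolP hx /asboolP hy];
  apply/asboolP => K.
- exact: rpred1.
- exact: rpredB (hx K) (hy K).
- exact: rpred_div (hx K) (hy K).
Qed.

HB.instance Definition _ (E : fieldType) :=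
  GRing.isDivringClosed.Build E (@prime_subfield E) (@prime_subfield_closed E).

Definition algebraic_over_prime_subfield (E : fieldType) : Prop :=
  forall x : E,
    algebraicOver (\val : subfield_type (@prime_subfield E) -> E) x.

(* An alias of [E], viewed as a vector space over its subfield [F]. *)
Definition ext_over (E : fieldType) (F : divringClosed E) : Type := E.

Section ExtOver.
Variables (E : fieldType) (F : divringClosed E).

HB.instance Definition _ := GRing.Zmodule.on (ext_over F).

Definition ext_scale (a : subfield_type F) (x : ext_over F) : ext_over F :=
  (\val a : E) * (x : E).

Fact ext_scaleA a b x : ext_scale a (ext_scale b x) = ext_scale (a * b) x.
Proof. by rewrite /ext_scale rmorphM mulrA. Qed.

Fact ext_scale1 : left_id 1 ext_scale.
Proof. by move=> x; rewrite /ext_scale rmorph1 mul1r. Qed.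

Fact ext_scaleDr : right_distributive ext_scale +%R.
Proof. by move=> a x y; rewrite /ext_scale mulrDr. Qed.

Fact ext_scaleDl x : {morph ext_scale^~ x : a b / a + b}.
Proof. by move=> a b; rewrite /ext_scale rmorphD mulrDl. Qed.

HB.instance Definition _ :=
  GRing.Zmodule_isLmodule.Build (subfield_type F) (ext_over F)
    ext_scaleA ext_scale1 ext_scaleDr ext_scaleDl.

End ExtOver.

Definition finite_dimensional (K : fieldType) (V : lmodType K) : Prop :=
  exists n : nat, inhabited (Vector.axiom n V).

(* Main.v *)
(** Every [x] in [E] is fixed by some iterate of the Frobenius map; let
    [degree x] be the least positive exponent [n] with [x ^+ (p ^ n) = x].
    Since [x] generates a subring with [p ^ degree x] elements, which are then
    all the roots of ['X^(p ^ degree x) - 'X], a subring containing [x]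
    contains every element whose degree divides [degree x]. Subrings are
    therefore determined by the prime powers occurring as degrees of their
    elements, and the maximal subrings of [T] correspond to the primes [q] for
    which these exponents are bounded and not all zero: if [q ^ k], [k > 0],
    is the largest power of [q] that is a degree in [T], the subring consists
    of the [x] in [T] with [~~ (q ^ k %| degree x)]. If [E] has finitely many
    such primes, and [N] is the product of the powers [q ^ k], then the
    elements of degree coprime to [N] form a subfield without maximal subrings
    over which the powers of an element of degree [N] form a basis. *)
Require Import Defs.
From HB Require Import structures.
From mathcomp Require Import all_boot all_order all_algebra.
From mathcomp Require Import cyclic.
From mathcomp Require Import all_classical.

Set Implicit Arguments.
Unset Strict Implicit.
Unset Printing Implicit Defensive.

Import GRing.Theory.

Local Open Scope classical_set_scope.
Local Open Scope ring_scope.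

(** * Finite intersections of subrings *)

Definition intersect_subring (R : pzRingType) (S T : subringClosed R) :
  {pred R} := [predI S & T].

Fact intersect_subring_closed (R : pzRingType) (S T : subringClosed R) :
  subring_closed (intersect_subring S T).
Proof.
split=> [|x y /andP[xS xT] /andP[yS yT]|x y /andP[xS xT] /andP[yS yT]];
  apply/andP; split; by rewrite ?rpred1 ?rpredB ?rpredM.
Qed.

HB.instance Definition _ (R : pzRingType) (S T : subringClosed R) :=
  GRing.isSubringClosed.Build R (intersect_subring S T)
    (intersect_subring_closed S T).

(** Term [n] involves only the [f m] with [m < n], so the chain starts at the whole ring and its
    step from [n] to [n.+1] cuts by [f n] alone. *)
Fixpoint intersect_chain (R : pzRingType) (f : nat -> subringClosed R)
    (n : nat) : subringClosed R :=
  if n is m.+1 then intersect_subring (intersect_chain f m) (f m)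
  else @full_subring R.

Lemma mem_intersect_chain (R : pzRingType) (f : nat -> subringClosed R) n x :
  (forall m, (m < n)%N -> x \in f m) -> x \in intersect_chain f n.
Proof.
elim: n => //= n IHn fx; apply/andP; split; last exact: fx.
by apply: IHn => m ltmn; apply: fx; apply: ltnW.
Qed.

(** * Frobenius iterates and degrees of elements *)

Section Frobenius.
Variables (E : fieldType) (p : nat) (charE : p \in [pchar E]).

Lemma frobenius_iterate n :
  exists f : {rmorphism E -> E}, forall x, f x = x ^+ (p ^ n).
Proof.
elim: n => [|n [f fE]]; first by exists idfun => x; rewrite expr1.
exists (f \o pFrobenius_aut charE) => x.
by rewrite /= fE pFrobenius_autE -exprM expnS.
Qed.

Lemma frobenius_inj n : injective (fun x : E => x ^+ (p ^ n)).
Proof.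
have [f fE] := frobenius_iterate n.
by move=> x y /=; rewrite -!fE; apply: fmorph_inj.
Qed.

(** The prime subfield lies in the fixed field of Frobenius, so all Frobenius iterates of [x] are
    roots of one nonzero polynomial. Two of them coincide, and injectivity cancels the smaller
    exponent. *)
Lemma frobenius_periodic :
  algebraic_over_prime_subfield E ->
  forall x : E, exists n, (0 < n)%N && (x ^+ (p ^ n) == x).
Proof.
move=> algE x; have [q q0 qx] := algE x.
have [f fE] := frobenius_iterate 1.
have fixC : divring_closed (fun c : E => f c == c).
  split=> [|a b|a b]; rewrite !unfold_in ?rmorph1 ?eqxx //.
    by rewrite rmorphB => /eqP-> /eqP->.
  by rewrite fmorph_div => /eqP-> /eqP->.
pose K : divringClosed E := HB.pack (fun c : E => f c == c)
  (GRing.isDivringClosed.Build E (fun c : E => f c == c) fixC).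
set Q := map_poly _ q in qx.
have Q0 : Q != 0 by rewrite map_poly_eq0.
have fQ : map_poly f Q = Q.
  apply/polyP => i; rewrite !coef_map /=.
  have /asboolP/(_ K) := valP q`_i.
  by move=> /eqP.
have rootQ i : root Q (x ^+ (p ^ i)).
  elim: i => [|i /eqP IH]; first by rewrite expr1.
  rewrite expnSr exprM -{2}(expn1 p) -fE /root -[in X in X.[_]]fQ.
  by rewrite horner_map IH rmorph0.
have : ~~ uniq [seq x ^+ (p ^ i) | i <- iota 0 (size Q)].
  apply/negP => U.
  have /(max_poly_roots Q0)/(_ U) :
      all (root Q) [seq x ^+ (p ^ i) | i <- iota 0 (size Q)].
    by apply/allP => _ /mapP[i _ ->].
  by rewrite size_map size_iota ltnn.
move=> /(uniqPn 0)[i [j [ltij]]]; rewrite size_map size_iota => ltj.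
have lti := ltn_trans ltij ltj.
rewrite !(nth_map 0%N) ?size_iota // !nth_iota // !add0n => eq_ij.
exists (j - i)%N; rewrite subn_gt0 ltij /=.
apply/eqP/(@frobenius_inj i) => /=.
by rewrite -exprM -expnD subnK // ltnW.
Qed.

Hypothesis per : forall x : E, exists n, (0 < n)%N && (x ^+ (p ^ n) == x).

(** This length of the Frobenius orbit is the degree of [x] over the prime field. *)
Definition degree (x : E) := ex_minn (per x).

Lemma degree_gt0 x : (0 < degree x)%N.
Proof. by rewrite /degree; case: ex_minnP => n /andP[]. Qed.

Lemma degree_dvd x m : (degree x %| m)%N = (x ^+ (p ^ m) == x).
Proof.
have fixM k : x ^+ (p ^ (k * degree x)) = x.
  rewrite /degree; case: ex_minnP => n /andP[_ /eqP xn] _.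
  by elim: k => [|k IHk]; rewrite ?expr1 // mulSn expnD exprM xn.
apply/idP/eqP => [/dvdnP[k ->] //|xm].
have xr : x ^+ (p ^ (m %% degree x)) = x.
  by rewrite -{1}[x](fixM (m %/ degree x)%N) -exprM -expnD -divn_eq.
rewrite /dvdn; apply: contraT; rewrite -lt0n => r_gt0.
have := ltn_pmod m (degree_gt0 x); rewrite ltnNge.
suff -> : (degree x <= m %% degree x)%N by [].
by rewrite {1}/degree; case: ex_minnP => n _; apply; rewrite r_gt0 xr eqxx.
Qed.

Lemma frobenius_eq x a b :
  x ^+ (p ^ a) = x ^+ (p ^ b) -> a = b %[mod degree x].
Proof.
wlog le_ab : a b / (a <= b)%N.
  move=> W; case: (leqP a b) => [|/ltnW] le; first exact: W.
  by move/esym/(W _ _ le).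
move=> eq_ab; apply/esym/eqP; rewrite eqn_mod_dvd // degree_dvd.
by apply/eqP/(@frobenius_inj a); rewrite /= -exprM -expnD subnK.
Qed.

Lemma degree1 : degree 1 = 1%N.
Proof. by apply/eqP; rewrite -dvdn1 degree_dvd expr1n. Qed.

Lemma degreeB x y : (degree (x - y) %| lcmn (degree x) (degree y))%N.
Proof.
rewrite degree_dvd.
have [f fE] := frobenius_iterate (lcmn (degree x) (degree y)).
rewrite -fE rmorphB !fE.
have /eqP-> : x ^+ (p ^ lcmn (degree x) (degree y)) == x.
  by rewrite -degree_dvd dvdn_lcml.
by have /eqP-> : y ^+ (p ^ lcmn (degree x) (degree y)) == y
  by rewrite -degree_dvd dvdn_lcmr.
Qed.

Lemma degreeM x y : (degree (x * y) %| lcmn (degree x) (degree y))%N.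
Proof.
rewrite degree_dvd exprMn.
have /eqP-> : x ^+ (p ^ lcmn (degree x) (degree y)) == x.
  by rewrite -degree_dvd dvdn_lcml.
by have /eqP-> : y ^+ (p ^ lcmn (degree x) (degree y)) == y
  by rewrite -degree_dvd dvdn_lcmr.
Qed.

Lemma degreeV x : degree x^-1 = degree x.
Proof.
have dvdV m : (degree x^-1 %| m)%N = (degree x %| m)%N.
  by rewrite !degree_dvd exprVn (inj_eq invr_inj).
by apply/eqP; rewrite eqn_dvd dvdV -[X in _ && X]dvdV !dvdnn.
Qed.

(** A Frobenius iterate that fixes [x + y] and one summand fixes the other. Hence [degree x] divides
    [degree (x + y) * degree y], and coprimality removes the second factor; likewise for
    [degree y]. *)
Lemma degreeD_coprime x y :
  coprime (degree x) (degree y) -> degree (x + y) = (degree x * degree y)%N.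
Proof.
move=> co; have dvdD a b k : (degree (a + b) %| k)%N -> (degree a %| k)%N ->
    (degree b %| k)%N.
  rewrite !degree_dvd; have [f fE] := frobenius_iterate k.
  by rewrite -!fE rmorphD => /eqP + /eqP fa; rewrite fa => /addrI->.
apply/eqP; rewrite eqn_dvd Gauss_dvd //; apply/and3P; split.
- rewrite degree_dvd; have [f fE] := frobenius_iterate (degree x * degree y).
  rewrite -fE rmorphD !fE; apply/eqP; congr (_ + _); apply/eqP.
    by rewrite -degree_dvd dvdn_mulr.
  by rewrite -degree_dvd dvdn_mull.
- have := dvdD y x (degree (x + y) * degree y)%N.
  by rewrite addrC dvdn_mulr // dvdn_mull // Gauss_dvdl //; apply.
have := dvdD x y (degree (x + y) * degree x)%N.
by rewrite dvdn_mulr // dvdn_mull // Gauss_dvdl 1?coprime_sym //; apply.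
Qed.

(* The [degree x] distinct conjugates of [x] under the [P]-th power of the
   Frobenius map are all roots of a polynomial of smaller degree. *)
Lemma rVpoly_root_eq0 x P (v : 'rV[E]_(degree x)) :
  coprime (degree x) P -> (forall i, v 0 i ^+ (p ^ P) = v 0 i) ->
  (rVpoly v).[x] = 0 -> v = 0.
Proof.
move=> co fixv vx.
suff v0 : rVpoly v = 0 by rewrite -[v]rVpolyK v0 linear0.
apply: contraTeq (size_poly _ _ : (size (rVpoly v) <= degree x)%N) => nz.
rewrite -ltnNge.
have := @max_poly_roots _ _
  [seq x ^+ (p ^ (P * j)) | j <- iota 0 (degree x)] nz.
rewrite size_map size_iota; apply.
  apply/allP => _ /mapP[j _ ->]; have [f fE] := frobenius_iterate (P * j).
  rewrite -fE /root -[in X in X.[_]](_ : map_poly f (rVpoly v) = rVpoly v).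
    by rewrite horner_map vx rmorph0.
  rewrite map_rVpoly; congr rVpoly; apply/rowP => i; rewrite mxE fE.
  by apply/eqP; rewrite -degree_dvd dvdn_mulr // degree_dvd fixv.
rewrite map_inj_in_uniq ?iota_uniq // => i j.
rewrite !mem_iota !add0n /= => lti ltj /frobenius_eq/eqP.
wlog le_ij : i j lti ltj / (i <= j)%N.
  move=> W; case: (leqP i j) => [|/ltnW] le; first exact: W.
  by rewrite eq_sym => /(W _ _ ltj lti le).
rewrite eq_sym eqn_mod_dvd ?leq_mul2l ?le_ij ?orbT // -mulnBr Gauss_dvdr //.
rewrite /dvdn modn_small ?(leq_ltn_trans (leq_subr _ _)) // => /eqP ji.
by apply/eqP; rewrite eqn_leq le_ij -subn_eq0 ji.
Qed.

(** The list holds the values at [x] of the polynomials of size at most [degree x] with coefficients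
    among [0, ..., p - 1]. These values are distinct by [rVpoly_root_eq0] with [P = 1], since
    Frobenius itself fixes the coefficients. *)
Lemma frobenius_fixed_seq x : exists s : seq E,
  [/\ uniq s, size s = (p ^ degree x)%N,
      {in s, forall y, y ^+ (p ^ degree x) = y} &
      {in s, forall y, exists2 v : 'rV[E]_(degree x),
        forall i, exists k, v 0 i = k%:R & y = (rVpoly v).[x]}].
Proof.
have p_pr := pcharf_prime charE.
pose c (v : 'rV['I_p]_(degree x)) : 'rV[E]_(degree x) :=
  map_mx (fun i : 'I_p => (i : nat)%:R) v.
pose g v := (rVpoly (c v)).[x].
have g_inj : injective g.
  move=> u v /eqP; rewrite -subr_eq0 -hornerN -hornerD -linearB /= => /eqP.
  move/(@rVpoly_root_eq0 _ 1) => cuv; apply/rowP => i; apply: val_inj => /=.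
  have {}cuv : c u - c v = 0.
    apply: cuv; first exact: coprimen1.
    move=> j; rewrite !mxE; have [f fE] := frobenius_iterate 1.
    by rewrite -fE rmorphB !rmorph_nat.
  move/subr0_eq/rowP/(_ i): cuv; rewrite !mxE.
  wlog le_uv : u v / (u 0%R i <= v 0%R i)%N.
    move=> W; case: (leqP (u 0%R i) (v 0%R i)) => [|/ltnW] le; first exact: W.
    by move/esym/(W _ _ le).
  move/esym/eqP; rewrite -subr_eq0 -natrB // -(dvdn_pcharf charE).
  rewrite /dvdn modn_small ?(leq_ltn_trans (leq_subr _ _)) // => /eqP vu.
  by apply/eqP; rewrite eqn_leq le_uv -subn_eq0 vu.
exists [seq g v | v <- enum 'rV['I_p]_(degree x)]; split.
- by rewrite map_inj_uniq ?enum_uniq.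
- by rewrite size_map -cardE card_mx card_ord mul1n.
- move=> _ /mapP[v _ ->]; have [f fE] := frobenius_iterate (degree x).
  rewrite -fE /g -horner_map fE.
  have /eqP-> : x ^+ (p ^ degree x) == x by rewrite -degree_dvd.
  congr (_.[_]); rewrite map_rVpoly; congr rVpoly.
  by apply/rowP => i; rewrite !mxE rmorph_nat.
move=> _ /mapP[v _ ->]; exists (c v) => // i.
by exists (v 0 i); rewrite mxE.
Qed.

(** The list of [frobenius_fixed_seq] already exhausts the roots of ['X^(p ^ degree x) - 'X], and
    [y] is one of them. *)
Lemma degree_dvd_poly x y : (degree y %| degree x)%N ->
  exists2 v : 'rV[E]_(degree x),
    forall i, exists k, v 0 i = k%:R & y = (rVpoly v).[x].
Proof.
have p_pr := pcharf_prime charE.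
rewrite degree_dvd => /eqP fy.
have [s [s_uniq s_size s_fix]] := frobenius_fixed_seq x; apply.
apply: contraT => ys; pose Q : {poly E} := 'X^(p ^ degree x) - 'X.
have p_gt1 : (1 < p ^ degree x)%N.
  by rewrite -(exp1n (degree x)) ltn_exp2r ?degree_gt0 // prime_gt1.
have szQ : size Q = (p ^ degree x).+1.
  by rewrite /Q size_polyDl ?size_polyXn // size_polyN size_polyX.
have := @max_poly_roots _ Q (y :: s); rewrite -size_poly_eq0 szQ /= s_size.
rewrite ltnn ys s_uniq => -> //.
have rootQ z : z ^+ (p ^ degree x) = z -> root Q z.
  by move=> fz; rewrite /root !hornerE fz subrr.
by rewrite rootQ //=; apply/allP => z /s_fix/rootQ.
Qed.

(** The nonzero elements of the fixed list contain a primitive root [g] of order [p ^ degree x - 1].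
    A power [h] of it has order [p ^ n - 1], which forces its Frobenius orbit to have length [n]. *)
Lemma degree_divisor_exists x n : (n %| degree x)%N -> exists y, degree y = n.
Proof.
move=> n_dvd; have p_gt1 := prime_gt1 (pcharf_prime charE).
have n_gt0 : (0 < n)%N := dvdn_gt0 (degree_gt0 x) n_dvd.
have pred_gt0 m : (0 < m)%N -> (0 < (p ^ m).-1)%N.
  case: m => // m _; rewrite -ltnS prednK ?expn_gt0 ?(ltnW p_gt1) //.
  by rewrite (leq_trans p_gt1) // -{1}(expn1 p) leq_exp2l.
have predE m (z : E) : z != 0 -> (z ^+ (p ^ m) == z) = (z ^+ (p ^ m).-1 == 1).
  move=> nz; rewrite -{1}[(p ^ m)%N]prednK ?expn_gt0 ?(ltnW p_gt1) // exprSr.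
  by rewrite -[X in _ == X]mul1r (inj_eq (mulIf nz)).
have [s [s_uniq s_size s_fix _]] := frobenius_fixed_seq x.
have : has (p ^ degree x).-1.-primitive_root [seq z <- s | z != 0].
  apply: has_prim_root; first exact/pred_gt0/degree_gt0.
  - apply/allP => z; rewrite mem_filter => /andP[nz /s_fix fz].
    by apply/unity_rootP/eqP; rewrite -predE // fz.
  - by rewrite filter_uniq.
  (* Zero occurs at most once in [s], so at least [p ^ degree x - 1] nonzero elements remain. *)
  have := count_predC (pred1 (0 : E)) s; rewrite s_size count_uniq_mem //.
  rewrite size_filter => <-; rewrite -subn1 leq_subLR leq_add2r.
  by case: (_ \in _).
case/hasP => g; rewrite mem_filter => /andP[nz _] g_prim.
have /(dvdn_prim_root g_prim) h_prim : ((p ^ n).-1 %| (p ^ degree x).-1)%N.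
  by rewrite -(divnK n_dvd) mulnC expnM dvdn_pred_predX.
set h := g ^+ _ in h_prim.
have nzh : h != 0 by rewrite expf_neq0.
have h_dvd m : (degree h %| m)%N = ((p ^ n).-1 %| (p ^ m).-1)%N.
  by rewrite degree_dvd predE // (prim_order_dvd h_prim).
exists h; apply/eqP; rewrite eqn_leq (dvdn_leq n_gt0) /= ?h_dvd //.
have : ((p ^ n).-1 %| (p ^ degree h).-1)%N by rewrite -h_dvd.
move/(dvdn_leq (pred_gt0 _ (degree_gt0 h))).
by rewrite -ltnS !prednK ?expn_gt0 ?(ltnW p_gt1) // leq_exp2l.
Qed.

End Frobenius.

(** * Subrings as determined by their degrees, and their truncations *)

Section Subrings.
Variables (E : fieldType) (p : nat) (charE : p \in [pchar E]).
Hypothesis per : forall x : E, exists n, (0 < n)%N && (x ^+ (p ^ n) == x).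
Implicit Types (S T U : subringClosed E) (x y : E) (n q k : nat).

Notation deg := (degree per).

Definition has_degree S n := exists2 x, x \in S & deg x = n.

Lemma mem_degree_dvd S x y : x \in S -> (deg y %| deg x)%N -> y \in S.
Proof.
move=> xS /(degree_dvd_poly charE)[v v_nat ->].
apply: rpred_horner => //; apply/polyOverP => i; rewrite coef_rVpoly.
case: insub => [j|]; last exact: rpred0.
by have [k ->] := v_nat j; apply: rpred_nat.
Qed.

Lemma has_degree_mem S x : has_degree S (deg x) -> x \in S.
Proof. by case=> y yS eq_deg; apply: mem_degree_dvd yS _; rewrite eq_deg. Qed.

Lemma has_degree_dvd S n k : has_degree S n -> (k %| n)%N -> has_degree S k.
Proof.
case=> x xS <- /[dup] k_dvd /(degree_divisor_exists charE)[y y_k].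
by exists y => //; apply: mem_degree_dvd xS _; rewrite y_k.
Qed.

Lemma has_degreeM S n k :
  has_degree S n -> has_degree S k -> coprime n k -> has_degree S (n * k).
Proof.
case=> x xS <- [y yS <-] co.
by exists (x + y); [apply: rpredD | apply: degreeD_coprime].
Qed.

Lemma has_degree1 S : has_degree S 1.
Proof. by exists 1; [apply: rpred1 | apply: degree1]. Qed.

Lemma has_degree_sub S T n :
  {subset S <= T} -> has_degree S n -> has_degree T n.
Proof. by move=> sST [x /sST xT <-]; exists x. Qed.

(** Degrees in a subring are closed under coprime products, so strong induction, splitting off the
    full power of one prime at a time, reduces inclusion to prime power degrees. *)
Lemma subringPn S T :
  ~ {subset T <= S} ->
  exists q k,
    [/\ prime q, (0 < k)%N, has_degree T (q ^ k) & ~ has_degree S (q ^ k)].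
Proof.
move=> nsTS.
suff [q [k [q_pr Tqk Sqk]]] :
    exists q k, [/\ prime q, has_degree T (q ^ k) & ~ has_degree S (q ^ k)].
  exists q, k; split=> //; rewrite lt0n; apply: contra_notN Sqk => /eqP->.
  exact: has_degree1.
apply: contra_notP nsTS => nqk x xT; apply: has_degree_mem.
have : has_degree T (deg x) by exists x.
have [n] := ubnP (deg x); elim: n (deg x) (degree_gt0 per x) => // n IHn m.
move=> m_gt0 ltmn Tm.
have [m_gt1|] := ltnP 1 m; last first.
  by case: m m_gt0 {ltmn Tm} => [|[|m]] // _ _; apply: has_degree1.
pose q := pdiv m; have q_pr : prime q := pdiv_prime m_gt1.
have [r co def_m] := pfactor_coprime q_pr m_gt0.
have l_gt0 : (0 < logn q m)%N by rewrite logn_gt0 mem_primes q_pr m_gt0 pdiv_dvd.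
have r_gt0 : (0 < r)%N by case: r def_m {co} => [E0|//]; rewrite E0 in m_gt0.
rewrite def_m; apply: has_degreeM; last by rewrite coprime_sym coprimeXl.
  apply: IHn => //; last by apply: has_degree_dvd Tm _; rewrite def_m dvdn_mulr.
  rewrite -ltnS; apply: leq_trans ltmn; rewrite ltnS def_m.
  by rewrite -{1}[r]muln1 ltn_pmul2l // -(expn0 q) ltn_exp2l // prime_gt1.
apply: contrapT => Sql; apply: nqk; exists q, (logn q m); split=> //.
by apply: has_degree_dvd Tm _; rewrite {2}def_m dvdn_mull.
Qed.

(** A relation rather than a function: closure under the ring operations is only proved for [q]
    prime and [k > 0]. *)
Definition truncation T q k S :=
  forall x, (x \in S) = (x \in T) && ~~ (q ^ k %| deg x)%N.

(** In the Steinitz number of [T], the formal lcm of its degrees, the exponent of [q] is finite,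
    positive and equal to [k]. *)
Definition exact_exponent T q k :=
  [/\ prime q, (0 < k)%N, has_degree T (q ^ k) & ~ has_degree T (q ^ k.+1)].

Lemma pfactor_dvd_lcm q k m n : prime q -> (0 < m)%N -> (0 < n)%N ->
  (q ^ k %| lcmn m n)%N = (q ^ k %| m)%N || (q ^ k %| n)%N.
Proof.
move=> q_pr m_gt0 n_gt0.
by rewrite !pfactor_dvdn ?lcmn_gt0 ?m_gt0 // logn_lcm // leq_max.
Qed.

(** A prime power dividing the lcm of two degrees divides one of them, which gives closure; [k > 0]
    keeps 1 in the set. *)
Lemma truncation_exists T q k :
  prime q -> (0 < k)%N -> exists S, truncation T q k S.
Proof.
move=> q_pr k_gt0; pose M x := (x \in T) && ~~ (q ^ k %| deg x)%N.
have M_closed : subring_closed M.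
  split=> [|x y /andP[xT xq] /andP[yT yq]|x y /andP[xT xq] /andP[yT yq]].
  - rewrite unfold_in /M rpred1 degree1 dvdn1 -(expn0 q) eqn_exp2l ?prime_gt1 //.
    by rewrite -lt0n.
  - rewrite unfold_in /M rpredB //.
    apply/negP => /dvdn_trans/(_ (degreeB charE per x y)).
    by rewrite pfactor_dvd_lcm ?degree_gt0 // (negPf xq) (negPf yq).
  rewrite unfold_in /M rpredM //.
  apply/negP => /dvdn_trans/(_ (degreeM per x y)).
  by rewrite pfactor_dvd_lcm ?degree_gt0 // (negPf xq) (negPf yq).
by exists (HB.pack M (GRing.isSubringClosed.Build E M M_closed)
  : subringClosed E).
Qed.

Lemma truncation_has_degree T q k S n :
  truncation T q k S -> has_degree S n <-> has_degree T n /\ ~~ (q ^ k %| n)%N.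
Proof.
move=> ST; split=> [[x + <-]|[[x xT <-] n_q]].
  by rewrite ST => /andP[xT ->]; split=> //; exists x.
by exists x; rewrite // ST xT.
Qed.

Lemma truncation_proper T q k S :
  has_degree T (q ^ k) -> truncation T q k S -> proper_subring S T.
Proof.
move=> Tqk ST; split=> [x|eST]; first by rewrite ST => /andP[].
have /(truncation_has_degree _ ST)[_] : has_degree S (q ^ k) by rewrite eST.
by rewrite dvdnn.
Qed.

(** A subring [U] strictly above [S] has the degree [q ^ k]. Any degree in [T] is [r * q ^ j] with
    [r] prime to [q] and [j <= k]; here [r] is a degree in [S] and [q ^ j] one in [U], so [U] is all
    of [T]. *)
Lemma truncation_maximal T q k S :
  exact_exponent T q k -> truncation T q k S -> maximal_subring S T.
Proof.
case=> q_pr k_gt0 Tqk Tqk1 ST; split; first exact: truncation_proper ST.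
move=> U [sUT neUT] sSU; apply: contrapT => neUS; apply: neUT.
apply: subring_ext => x; apply/idP/idP => [/sUT //|xT].
have [y yU yS] : exists2 y, y \in U & y \notin S.
  apply: contrapT => noy; apply: neUS; apply: subring_ext => y.
  apply/idP/idP => [yU|/sSU //]; apply: contrapT => /negP yS; apply: noy.
  by exists y.
have Uqk : has_degree U (q ^ k).
  move: yS; rewrite ST (sUT _ yU) /= negbK => /(has_degree_dvd _); apply.
  by exists y.
apply: has_degree_mem.
have [r co def_x] := pfactor_coprime q_pr (degree_gt0 per x).
have Tx : has_degree T (deg x) by exists x.
have le_k : (logn q (deg x) <= k)%N.
  rewrite leqNgt; apply/negP => ltk; apply: Tqk1; apply: has_degree_dvd Tx _.
  by rewrite pfactor_dvdn ?degree_gt0.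
rewrite def_x; apply: has_degreeM.
- apply: has_degree_sub sSU _; apply/(truncation_has_degree _ ST); split.
    by apply: has_degree_dvd Tx _; rewrite def_x dvdn_mulr.
  apply/negP => /(dvdn_trans (dvdn_exp k_gt0 (dvdnn q))).
  by apply/negP; rewrite -prime_coprime.
- by apply: has_degree_dvd Uqk _; rewrite dvdn_exp2l.
by rewrite coprime_sym coprimeXl.
Qed.

(** If [S] lacks the degree [q ^ k] of [T], the truncation of [T] at [q ^ k] contains [S], hence
    equals it. Were [q ^ k.+1] a degree in [T], the truncation there would equal [S] too, although
    it keeps [q ^ k]. *)
Lemma maximal_truncation S T : maximal_subring S T ->
  exists q k, exact_exponent T q k /\ truncation T q k S.
Proof.
case=> [[sST neST] maxS].
have /subringPn[q [k [q_pr k_gt0 Tqk Sqk]]] : ~ {subset T <= S}.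
  move=> sTS; apply: neST; apply: subring_ext => x.
  by apply/idP/idP => [/sST|/sTS].
have [M MT] := truncation_exists T q_pr k_gt0.
have eqMS j N : (k <= j)%N -> truncation T q j N -> has_degree T (q ^ j) -> N = S.
  move=> le_kj NT Tqj; apply: maxS; first exact: truncation_proper NT.
  move=> x xS; rewrite NT sST //=; apply: contra_notN Sqk => qx.
  have : has_degree S (deg x) by exists x.
  by move=> /has_degree_dvd; apply; apply: dvdn_trans qx; rewrite dvdn_exp2l.
exists q, k; split; last by rewrite -(eqMS _ _ _ MT).
split=> // Tqk1; apply: Sqk.
have [N NT] := truncation_exists T q_pr (ltn0Sn k).
rewrite -(eqMS _ _ _ NT) //; apply/(truncation_has_degree _ NT); split=> //.
by rewrite dvdn_Pexp2l ?prime_gt1 // ltnn.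
Qed.

(** An isomorphism preserves the equations that define degrees, and membership in a subring depends
    only on the degree. *)
Lemma ring_isomorphic_eq S T :
  ring_isomorphic (subring_type S) (subring_type T) -> S = T.
Proof.
case=> f [g fK gK].
have deg_f (a : subring_type S) : deg (\val a) = deg (\val (f a)).
  have dvd_f m : (deg (\val a) %| m)%N = (deg (\val (f a)) %| m)%N.
    rewrite !degree_dvd -!rmorphXn !(inj_eq val_inj).
    by rewrite (can_eq fK).
  by apply/eqP; rewrite eqn_dvd dvd_f -[X in _ && X]dvd_f !dvdnn.
apply: subring_ext => x; apply/idP/idP => [xS|xT].
  have := deg_f (SubringElt xS); set b := f _ => /= deg_b.
  by apply: mem_degree_dvd (valP b) _; rewrite -deg_b.
have := deg_f (g (SubringElt xT)); rewrite gK /=; set b := g _ => deg_b.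
by apply: mem_degree_dvd (valP b) _; rewrite deg_b.
Qed.

Lemma finite_up_to_iso_finite (C : set (subringClosed E)) :
  finite_up_to_iso C -> finite_set C.
Proof.
move=> finC; have -> : C = \bigcup_(A in [set iso_class C S | S in C]) A.
  apply/seteqP; split=> [S CS|S [_ [T CT <-]] [] //].
  exists (iso_class C S); first by exists S.
  by split=> //; exists idfun; exists idfun.
apply: bigcup_finite => // _ [S CS <-].
apply: (sub_finite_set _ (finite_set1 S)) => T [_ iST].
exact/esym/ring_isomorphic_eq.
Qed.

End Subrings.

(** * Maximal subrings, subfields of finite codimension and chains *)

Section MaximalSubrings.
Variables (E : fieldType) (p : nat) (charE : p \in [pchar E]).
Hypothesis per : forall x : E, exists n, (0 < n)%N && (x ^+ (p ^ n) == x).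
Implicit Types (S T : subringClosed E) (x y : E) (n q k : nat).

Notation deg := (degree per).
Notation full := (@full_subring E : subringClosed E).

Lemma exact_exponent_inj T q k k' :
  exact_exponent per T q k -> exact_exponent per T q k' -> k = k'.
Proof.
wlog lt_kk' : k k' / (k < k')%N.
  move=> W; case: (ltngtP k k') => // lt ek ek'; first exact: W.
  by apply/esym; apply: W.
case=> _ _ _ Tk1 [_ _ Tk' _]; case: Tk1.
by apply: (has_degree_dvd charE Tk'); rewrite dvdn_exp2l.
Qed.

Lemma prime_power_ndvd q q' k k' :
  prime q -> prime q' -> q != q' -> (0 < k)%N -> ~~ (q ^ k %| q' ^ k')%N.
Proof.
move=> q_pr q'_pr neq k_gt0; apply/negP => /(dvdn_trans (dvdn_exp k_gt0 (dvdnn q))).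
by rewrite Euclid_dvdX // dvdn_prime2 // (negPf neq).
Qed.

(** For distinct primes, [q ^ k] survives the truncation at [q'] but not the one at [q]. *)
Lemma truncation_prime_inj T q k q' k' S :
  exact_exponent per T q k -> truncation per T q k S ->
  exact_exponent per T q' k' -> truncation per T q' k' S -> q = q'.
Proof.
move=> [q_pr k_gt0 Tqk _] Sq [q'_pr k'_gt0 _ _] Sq'; apply: contrapT => /eqP neq.
have /(truncation_has_degree _ Sq)[_] : has_degree per S (q ^ k).
  apply/(truncation_has_degree _ Sq'); split=> //.
  by rewrite prime_power_ndvd // eq_sym.
by rewrite dvdnn.
Qed.

Lemma no_maximal_subringsP T :
  maximal_subrings T = set0 <-> forall q k, ~ exact_exponent per T q k.
Proof.
split=> [T0 q k ex|nex].
  have [q_pr k_gt0 _ _] := ex.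
  have [S ST] := truncation_exists charE per T q_pr k_gt0.
  suff : maximal_subrings T S by rewrite T0.
  exact: truncation_maximal ST.
rewrite -subset0 => S /(maximal_truncation charE per)[q [k [ex _]]].
exact: nex ex.
Qed.

Lemma has_degree_all_powers T q k j : prime q -> (0 < k)%N ->
  (forall k', ~ exact_exponent per T q k') ->
  has_degree per T (q ^ k) -> has_degree per T (q ^ j).
Proof.
move=> q_pr k_gt0 nex Tqk.
have Tkj : has_degree per T (q ^ (k + j)).
  elim: j => [|j IHj]; first by rewrite addn0.
  rewrite addnS; apply: contrapT => nT; apply: (nex (k + j)%N).
  by split=> //; rewrite addn_gt0 k_gt0.
by apply: (has_degree_dvd charE Tkj); rewrite dvdn_exp2l // leq_addl.
Qed.

Lemma finite_exact_primes : finite_set (maximal_subrings full) ->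
  finite_set [set q | exists k, exact_exponent per full q k].
Proof.
(* [g] sends a maximal subring to its prime; the default 0 is taken only at subrings that are not
   maximal. *)
pose g S := xget 0%N [set q | exists2 k,
  exact_exponent per full q k & truncation per full q k S].
move=> /(finite_image g); apply: sub_finite_set => q [k ex].
have [q_pr k_gt0 _ _] := ex.
have [S ST] := truncation_exists charE per full q_pr k_gt0.
exists S; first exact: truncation_maximal ST.
rewrite /g; case: xgetP => [q' _ [k' ex' ST']|/(_ q)]; last by case; exists k.
exact: truncation_prime_inj ex' ST' ex ST.
Qed.

Lemma maximal_exact_degree : finite_set (maximal_subrings full) ->
  exists N, [/\ has_degree per full N,
    forall q k, exact_exponent per full q k -> (q ^ k %| N)%N &
    forall q, prime q -> (q %| N)%N -> exists k, exact_exponent per full q k].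
Proof.
move=> /finite_exact_primes/finite_seqP[s sE].
have {}sE q : q \in s <-> exists k, exact_exponent per full q k.
  by have /(congr1 (fun A => A q))/= -> := sE.
pose e q := xget 0%N [set k | exact_exponent per full q k].
have eP q : q \in undup s -> exact_exponent per full q (e q).
  by rewrite mem_undup => /sE[k ex]; rewrite /e; case: xgetP => [//|/(_ k)].
have dvdP (t : seq nat) q : {subset t <= undup s} -> prime q ->
    (q %| \prod_(r <- t) r ^ e r)%N -> q \in t.
  move=> sub q_pr; rewrite Euclid_dvd_prod // big_has => /hasP[r rt].
  have [r_pr _ _ _] := eP _ (sub _ rt).
  by rewrite Euclid_dvdX // dvdn_prime2 // => /andP[/eqP->].
exists (\prod_(q <- undup s) q ^ e q)%N; split.
- have: {subset undup s <= undup s} by []; have := undup_uniq s.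
  (* The trivial inclusion lets the induction run over tails [t] while [eP] still speaks of
     [undup s]. *)
  elim: {1 2 4}(undup s) => [_ _|q t IHt /= /andP[qt t_uniq] sub].
    by rewrite big_nil; apply: has_degree1.
  have [q_pr _ Eq _] := eP q (sub _ (mem_head _ _)).
  have subt : {subset t <= undup s}.
    by move=> r rt; apply: sub; rewrite inE rt orbT.
  rewrite big_cons; apply: has_degreeM => //; first exact: IHt.
  by rewrite coprimeXl // prime_coprime //; apply: contra qt; apply: dvdP.
- move=> q k ex; have qs : q \in undup s by rewrite mem_undup; apply/sE; exists k.
  rewrite (exact_exponent_inj ex (eP q qs)).
  by rewrite (bigD1_seq q) ?undup_uniq //= dvdn_mulr.
by move=> q q_pr /(dvdP _ _ (fun _ h => h) q_pr) qs; exists (e q); apply: eP.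
Qed.

Lemma finite_maximal_subfield : finite_set (maximal_subrings full) ->
  exists F : divringClosed E,
    maximal_subrings F = set0 /\ finite_dimensional (ext_over F).
Proof.
move=> /maximal_exact_degree[N [[theta _ deg_theta] exN Nex]].
pose P x := coprime (deg x) N.
have P_closed : divring_closed P.
  have dvdP (a b c : E) : (deg a %| lcmn (deg b) (deg c))%N -> P b -> P c -> P a.
    move=> dvd_a Pb Pc; apply: (@coprime_dvdl _ (deg b * deg c)%N).
      by apply: dvdn_trans dvd_a _; rewrite dvdn_lcm dvdn_mulr // dvdn_mull.
    by rewrite coprimeMl; apply/andP.
  split=> [|x y|x y]; rewrite !unfold_in.
  - by rewrite /P degree1 coprime1n.
  - exact/dvdP/degreeB.
  by apply: dvdP; rewrite -[in X in (_ %| X)%N](degreeV per y); apply: degreeM.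
have [F memF] : exists F : divringClosed E, forall x, (x \in F) = coprime (deg x) N.
  by exists (HB.pack P (GRing.isDivringClosed.Build E P P_closed)
    : divringClosed E).
exists F; split.
  (* A prime coprime to [N] has no exact exponent in [E]. Once it occurs as a degree, all its powers
     occur, and elements of these degrees lie in [F]. *)
  apply/no_maximal_subringsP => q k [q_pr k_gt0 [x xF deg_x] Fqk1].
  have co_qN : coprime q N.
    by move: xF; rewrite memF deg_x coprime_pexpl.
  have [] : has_degree per full (q ^ k.+1).
    apply: (has_degree_all_powers _ q_pr k_gt0) => [k' ex|]; last by exists x.
    have [_ k'_gt0 _ _] := ex; move: co_qN; rewrite prime_coprime //.
    by rewrite (dvdn_trans _ (exN _ _ ex)) // dvdn_exp.
  move=> y _ deg_y; apply: Fqk1; exists y => //.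
  by rewrite memF deg_y coprimeXl.
exists (deg theta).
pose r2v (v : 'rV[subfield_type F]_(deg theta)) : ext_over F :=
  (rVpoly (map_mx \val v)).[theta].
have r2v_lin a u v : r2v (a *: u + v) = a *: r2v u + r2v v.
  by rewrite /r2v map_mxD map_mxZ linearD linearZ /= hornerD hornerZ.
have r2v0 : r2v 0 = 0 by rewrite /r2v map_mx0 linear0 horner0.
have r2vZ a u : r2v (a *: u) = a *: r2v u by rewrite -[a *: u]addr0 r2v_lin r2v0 addr0.
have r2vD u v : r2v (u + v) = r2v u + r2v v by rewrite -[u]scale1r r2v_lin !scale1r.
have r2v_inj : injective r2v.
  suff ker0 w : r2v w = 0 -> w = 0.
    move=> u v eq_uv; apply/subr0_eq/ker0.
    by rewrite -scaleN1r addrC r2v_lin eq_uv scaleN1r addNr.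
  rewrite /r2v => /(rVpoly_root_eq0 charE) w0.
  apply/rowP => i; apply: val_inj.
  suff /rowP/(_ i) : map_mx (\val : subfield_type F -> E) w = 0 by rewrite !mxE.
  (* The product of the degrees of the coefficients is prime to [deg theta], and that iterate of
     Frobenius fixes every coefficient. *)
  apply: (w0 (\prod_j deg (\val (w 0%R j)))%N).
    rewrite coprime_sym.
    apply: (big_ind (fun m => coprime m (deg theta))) => [|a b Pa Pb|j _].
    - exact: coprime1n.
    - by rewrite coprimeMl Pa.
    by have := valP (w 0 j); rewrite memF -deg_theta.
  move=> j; apply/eqP; rewrite mxE -degree_dvd.
  by rewrite (bigD1 j) //= dvdn_mulr.
have r2v_horner (g : {poly subfield_type F}) :
    exists v, (map_poly \val g).[theta] = r2v v.
  rewrite horner_coef.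
  apply: (big_ind (fun y => exists v, y = r2v v)) => [|_ _ [u ->] [v ->]|i _].
  - by exists 0.
  - by exists (u + v); rewrite r2vD.
  (* Powers of [theta] are reduced to polynomials of size at most [deg theta] by degree
     divisibility, in place of a minimal polynomial. *)
  have [] := degree_dvd_poly charE (_ : (deg (theta ^+ i) %| deg theta)%N).
    rewrite degree_dvd -exprM mulnC exprM.
    by have /eqP-> : theta ^+ (p ^ deg theta) == theta by rewrite -degree_dvd.
  move=> v /choice[c cE] ->; exists (g`_i *: \row_j (c j)%:R).
  rewrite r2vZ coef_map; congr (_ * _); rewrite /r2v.
  congr (rVpoly _).[_]; apply/rowP => j; by rewrite !mxE rmorph_nat cE.
have r2v_surj x : exists v, x = r2v v.
  pose W y := `[< exists g : {poly subfield_type F}, y = (map_poly \val g).[theta] >].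
  have W_closed : subring_closed W.
    split=> [|y z /asboolP[g ->] /asboolP[h ->]|y z /asboolP[g ->] /asboolP[h ->]];
      apply/asboolP.
    - by exists 1; rewrite rmorph1 hornerE.
    - by exists (g - h); rewrite rmorphB !hornerE.
    by exists (g * h); rewrite rmorphM !hornerE.
  pose WS : subringClosed E :=
    HB.pack W (GRing.isSubringClosed.Build E W W_closed).
  suff /asboolP[g ->] : x \in WS by exact: r2v_horner.
  (* [WS] is [F[theta]]. A prime power degree [q ^ k] of [E] divides [N], the degree of [theta],
     when [q] divides [N]; otherwise the elements of that degree lie in [F]. *)
  apply: contrapT => xW.
  have /(subringPn charE per)[q [k [q_pr k_gt0 Eqk]]] : ~ {subset full <= WS}.
    by move=> /(_ x)/(_ isT).
  apply; have [qN|co_qN] := boolP (q %| N)%N.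
    have WN : has_degree per WS N.
      exists theta => //; apply/asboolP; exists 'X.
      by rewrite map_polyX hornerX.
    have [e ex] := Nex q q_pr qN.
    apply: (has_degree_dvd charE WN); apply: dvdn_trans (exN _ _ ex).
    rewrite dvdn_exp2l // leqNgt; apply/negP => lt_ek.
    have [_ _ _] := ex; apply; apply: (has_degree_dvd charE Eqk).
    by rewrite dvdn_exp2l.
  have [y _ deg_y] := Eqk; exists y => //; apply/asboolP.
  have yF : y \in F by rewrite memF deg_y coprimeXl // prime_coprime.
  by exists (SubfieldElt yF)%:P; rewrite map_polyC hornerC.
have [g r2vK gK] : bijective r2v.
  pose g x := projT1 (cid (r2v_surj x)).
  have gK : cancel g r2v by move=> x; rewrite /g; case: cid.
  by exists g => // v; apply: r2v_inj; rewrite gK.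
constructor; exists g; last by exists r2v.
by move=> a u v; apply: r2v_inj; rewrite r2v_lin !gK.
Qed.

(* Each step of a chain removes a degree [q ^ k] that divides the product [N] of
   the degrees of a basis over [F]. *)
Lemma finite_codim_no_chain (F : divringClosed E) :
  maximal_subrings F = set0 -> finite_dimensional (ext_over F) ->
  ~ exists Rs : nat -> subringClosed E,
      Rs 0%N = full /\ forall i, maximal_subring (Rs i.+1) (Rs i).
Proof.
move=> /no_maximal_subringsP nexF [n [[f0 f_lin [g fK gK]]]] [Rs [Rs0 maxR]].
pose f : {linear ext_over F -> 'rV_n} :=
  HB.pack f0 (GRing.isLinear.Build _ _ _ _ f0 f_lin).
pose b i : ext_over F := g (delta_mx 0 i).
have bE (x : ext_over F) : x = \sum_i f x 0 i *: b i.
  apply: (can_inj fK); rewrite -[f0]/(f : _ -> _) linear_sum {1}[f x]row_sum_delta.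
  by apply: eq_bigr => i _; rewrite linearZ /= /b gK.
pose N := (\prod_i deg (b i))%N.
have N_gt0 : (0 < N)%N by apply: prodn_gt0 => i; apply: degree_gt0.
have dvdN q k : prime q -> (0 < k)%N -> ~ has_degree per F q ->
    has_degree per full (q ^ k) -> (q ^ k %| N)%N.
  move=> q_pr k_gt0 nFq [x _ deg_x]; apply: contraT => qN.
  (* If [q ^ k] did not divide [N], truncating [E] at [q ^ k] would keep [F] and the whole basis,
     hence all of [E], including [x]. *)
  have [S ST] := truncation_exists charE per full q_pr k_gt0.
  suff : x \in S by rewrite ST deg_x dvdnn andbF.
  rewrite (bE x); apply: rpred_sum => i _; apply: rpredM.
    rewrite ST /=; apply/negP => q_dvd; apply: nFq.
    have Fc : has_degree per F (deg (\val (f x 0 i))).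
      by exists (\val (f x 0 i)) => //; apply: valP.
    apply: (has_degree_dvd charE Fc).
    by apply: dvdn_trans q_dvd; apply: dvdn_exp.
  rewrite ST /=; apply: contra qN => /dvdn_trans; apply.
  by rewrite /N (bigD1 i) //= dvdn_mulr.
have sFR i : {subset F <= Rs i}.
  elim: i => [|i IHi] x xF; first by rewrite Rs0.
  (* If the truncation removed an element of [F], then [k] would be an exact exponent of [q] in
     [F]. *)
  have [q [k [[q_pr k_gt0 Rk Rk1] RT]]] := maximal_truncation charE per (maxR i).
  rewrite RT IHi //=; apply/negP => q_dvd; apply: (nexF q k); split=> //.
    have Fx : has_degree per F (deg x) by exists x.
    exact: (has_degree_dvd charE Fx).
  by move=> /(has_degree_sub IHi).
pose D i := [set d : 'I_N.+1 | (d %| N)%N && `[< has_degree per (Rs i) d >]]%SET.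
have D_proper i : D i.+1 \proper D i.
  have [q [k [ex RT]]] := maximal_truncation charE per (maxR i).
  have [q_pr k_gt0 Rk Rk1] := ex.
  have qN : (q ^ k %| N)%N.
    apply: dvdN => //; last by case: Rk => x _ <-; exists x.
    (* If [q] were a degree in [F], so would be all its powers, and [Rs i] contains [F]. *)
    move=> Fq; apply: Rk1; apply: (has_degree_sub (sFR i)).
    by apply: (has_degree_all_powers _ q_pr (ltnSn 0)) => //; rewrite expn1.
  have ltN : (q ^ k < N.+1)%N by rewrite ltnS dvdn_leq.
  apply/properP; split.
    apply/fintype.subsetP => d; rewrite !inE => /andP[-> /asboolP Rd] /=.
    by have [Rd' _] := (truncation_has_degree _ RT).1 Rd; apply/asboolP.
  exists (Ordinal ltN); rewrite !inE /= qN /=; first exact/asboolP.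
  by apply/asboolP => /(truncation_has_degree _ RT)[_]; rewrite dvdnn.
have card_D i : (#|D i| + i <= #|D 0|)%N.
  elim: i => [|i IHi]; first by rewrite addn0.
  by apply: leq_trans IHi; rewrite addnS -addSn leq_add2r proper_card.
have := card_D #|D 0|.+1; rewrite addnS ltnNge leq_addl //.
Qed.

(** Distinct maximal subrings of [E] truncate at distinct primes. Intersecting infinitely many of
    them one by one truncates at a new prime each time, and each intersection is maximal in the
    preceding one. *)
Lemma no_chain_finite :
  ~ (exists Rs : nat -> subringClosed E,
      Rs 0%N = full /\ forall i, maximal_subring (Rs i.+1) (Rs i)) ->
  finite_set (maximal_subrings full).
Proof.
apply: contra_notP => /infiniteP/card_leP[h].
pose f n := set_val (h (to_setT n)).
have f_inj : injective f.
  move=> n m /val_inj eq_h; suff /(congr1 val) : to_setT n = to_setT m by [].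
  by apply: (inj (f := h)) eq_h; rewrite inE.
have ex n : exists q k, exact_exponent per full q k /\ truncation per full q k (f n).
  by apply: (maximal_truncation charE); apply: set_mem (valP (h (to_setT n))).
have [q /choice[k qkE]] := choice ex.
have q_inj n m : q n = q m -> n = m.
  move=> eq_q; apply: f_inj.
  have [[exn nT] [exm mT]] := (qkE n, qkE m).
  rewrite -eq_q in exm mT; have eq_k := exact_exponent_inj exn exm.
  by apply: subring_ext => x; rewrite nT mT eq_k.
exists (intersect_chain f); split=> // i.
have [[q_pr k_gt0 [x _ deg_x] Eqk1] iT] := qkE i.
apply: (truncation_maximal charE (q := q i) (k := k i)); last first.
  move=> y; rewrite [LHS](_ : _ = (y \in intersect_chain f i) && (y \in f i)) //.
  by rewrite iT.
split=> //; last by apply: contra_not Eqk1; apply: has_degree_sub.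
(* The earlier truncations concern other primes, so they keep the element of degree [q i ^ k i]. *)
exists x => //; apply: mem_intersect_chain => j lt_ji.
have [[qj_pr kj_gt0 _ _] jT] := qkE j; rewrite jT deg_x /=.
apply: prime_power_ndvd => //; apply: contraTneq lt_ji => /q_inj->.
by rewrite ltnn.
Qed.

End MaximalSubrings.

(** * The cycle of implications *)

Theorem corollary3p3 (E : fieldType) (p : nat)
    (charE : p \in [pchar E]) (algE : algebraic_over_prime_subfield E) :
  [<-> finite_up_to_iso (maximal_subrings (@full_subring E));
       finite_set (maximal_subrings (@full_subring E));
       exists F : divringClosed E,
         maximal_subrings F = set0 /\ finite_dimensional (ext_over F);
       ~ exists Rs : nat -> subringClosed E,
           Rs 0%N = @full_subring E /\
           forall i : nat, maximal_subring (Rs i.+1) (Rs i)].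
Proof.
have per := frobenius_periodic charE algE.
tfae.
- exact: finite_up_to_iso_finite charE per _.
- exact: finite_maximal_subfield charE per.
- by move=> [F [F0 finF]]; apply: finite_codim_no_chain charE per F F0 finF.
(* The isomorphism classes are an image of the set of maximal subrings, so finiteness of the latter
   suffices. *)
by move=> /(no_chain_finite charE per); apply: finite_image.
Qed.
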